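(* The set $$\mathcal{D}=\{f\in C[0,1]: \text{there exists a non-empty perfect set } P_f\subset[0,1] \text{ such that } f'(x)=\infty \text{ for all } x\in P_f\}$$ is Haar ambivalent in $C[0,1]$.
   Context: $C[0,1]$ is the Banach space of continuous functions $f\colon[0,1]\to\mathbb{R}$ with the supremum metric, regarded as an abelian Polish group under addition. A set $A\subset C[0,1]$ is shy (or Haar null) if there exist a Borel set $B\subset C[0,1]$ and a Borel probability measure $\mu$ on $C[0,1]$ such that $A\subset B$ and $\mu(B+f)=0$ for all $f\in C[0,1]$. A set is prevalent if its complement is shy. A set is Haar ambivalent if it is neither shy nor prevalent. A set is perfect if it is closed and has no isolated points. For $x\in[0,1]$, $f'(x)=\infty$ means $\lim_{z\to x}\frac{f(z)-f(x)}{z-x}=+\infty$, the limit being over $z\in[0,1]\setminus\{x\}$ (so it is one-sided at the endpoints). *)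

(* Defs.v *)
From HB Require Import structures.
From mathcomp Require Import all_boot all_order all_algebra.
From mathcomp Require Import all_classical all_reals all_analysis.

Set Implicit Arguments.
Unset Strict Implicit.
Unset Printing Implicit Defensive.

Import Order.TTheory GRing.Theory Num.Theory.
Import numFieldNormedType.Exports.

Local Open Scope classical_set_scope.
Local Open Scope ring_scope.

(* [set_type] carries the topology induced from R. *)
Notation I01 R := (set_type (`[0%R, 1%R]%classic : set R)).

Definition C01 (R : realType) : Type := continuousType (I01 R) R.

(* Uniform convergence on all of [0,1], i.e. the topology of the supremum
   metric (see [open_C01P] below). *)
HB.instance Definition _ (R : realType) := PseudoMetric.copy (C01 R)
  (initial_topology
     (id : continuousType (I01 R) R -> arrow_uniform_type (I01 R) R)).

Section zmodule.
Variable R : realType.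
Implicit Types f g h : C01 R.

Definition C01_fun (f : C01 R) : I01 R -> R := Continuous.sort f.

Lemma C01_fun_continuous f : continuous (C01_fun f).
Proof. exact: cts_fun. Qed.

Lemma C01_addf_subproof f g : continuous (fun x => C01_fun f x + C01_fun g x).
Proof. by move=> x; exact: (cvgD (@C01_fun_continuous f x) (@C01_fun_continuous g x)). Qed.

Lemma C01_oppf_subproof f : continuous (fun x => - C01_fun f x).
Proof. by move=> x; exact: (cvgN (@C01_fun_continuous f x)). Qed.

Definition C01_zero : C01 R := (cst 0 : I01 R -> R) : continuousType _ _.
Definition C01_add f g : C01 R :=
  mkcts (@C01_addf_subproof f g) : continuousType _ _.
Definition C01_opp f : C01 R :=
  mkcts (@C01_oppf_subproof f) : continuousType _ _.

Lemma C01P f g : C01_fun f =1 C01_fun g -> f = g.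
Proof. by move=> fg; apply/continuousEP. Qed.

Lemma C01_addA : associative C01_add.
Proof. by move=> f g h; apply: C01P => x; exact: addrA. Qed.
Lemma C01_addC : commutative C01_add.
Proof. by move=> f g; apply: C01P => x; exact: addrC. Qed.
Lemma C01_add0 : left_id C01_zero C01_add.
Proof. by move=> f; apply: C01P => x; exact: add0r. Qed.
Lemma C01_addN : left_inverse C01_zero C01_opp C01_add.
Proof. by move=> f; apply: C01P => x; exact: addNr. Qed.

HB.instance Definition _ := GRing.isZmodule.Build (C01 R)
  C01_addA C01_addC C01_add0 C01_addN.

HB.instance Definition _ := isPointed.Build (C01 R) 0.

Lemma C01_addE f g x : C01_fun (f + g) x = C01_fun f x + C01_fun g x.
Proof. by []. Qed.

Lemma ball_C01E f (e : R) g :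
  ball f e g <-> forall x, `|C01_fun f x - C01_fun g x| < e.
Proof. by []. Qed.

Lemma open_C01P (U : set (C01 R)) :
  open U <-> forall f, U f -> exists2 e : R, 0 < e &
    forall g, (forall x, `|C01_fun f x - C01_fun g x| < e) -> U g.
Proof.
rewrite openE; split=> [oU f /oU/nbhs_ballP[e e0 fe]|oU f /oU[e e0 fe]].
  by exists e => // g fg; apply: fe; exact/ball_C01E.
by apply/nbhs_ballP; exists e => // g /ball_C01E; exact: fe.
Qed.

End zmodule.

Coercion C01_fun : C01 >-> Funclass.

Notation borel_C01 R := (g_sigma_algebraType (@open (C01 R))).

Definition shy (R : realType) (A : set (C01 R)) : Prop :=
  exists (B : set (C01 R)) (mu : probability (borel_C01 R) R),
    [/\ measurable (B : set (borel_C01 R)), A `<=` B &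
        forall f : C01 R, mu [set g + f | g in B] = 0%E].

Definition prevalent (R : realType) (A : set (C01 R)) : Prop := shy (~` A).

Definition Haar_ambivalent (R : realType) (A : set (C01 R)) : Prop :=
  ~ shy A /\ ~ prevalent A.

(* [x^'] is the filter of deleted neighbourhoods of x in the subtype, so the
   limit is one-sided when x is 0 or 1. *)
Definition infinite_derivative (R : realType) (f : C01 R) (x : I01 R) : Prop :=
  (f z - f x) / (val z - val x) @[z --> x^'] --> +oo.

Definition infinite_derivative_on_perfect (R : realType) : set (C01 R) :=
  [set f | exists P : set (I01 R),
     [/\ P !=set0, perfect_set P & forall x, P x -> infinite_derivative f x]].

(* Main.v *)
Require Import Defs.
From mathcomp Require Import all_boot all_order all_algebra.
From mathcomp Require Import all_classical all_reals all_analysis.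
From mathcomp Require Import ring lra.

(** A set [A] cannot be shy as soon as it contains a translate of every compact
    set: a Borel probability measure [mu] charges some compact [K], a translate
    of [K] lies in [A], hence [K] lies in a translate of any Borel [B]
    containing [A], and that translate is not [mu]-null. In C[0,1] compactness
    only enters through a common modulus of continuity, so [K] is replaced by
    the set [modulus_set delta eps] of functions oscillating by at most [eps n]
    on intervals of length [delta n]. For a fixed sequence [eps], every [mu]
    charges this set for a suitable [delta] ([modulus_set_tight]), because each
    function is uniformly continuous. It remains to find, for every [delta],
    one [g] with [f + g] in the given set for all [f] in the modulus set
    ([not_shy_of_translates]); this is done for the set of the theorem and for
    its complement.

    For the set itself, [g] increases very steeply along a very thin Cantor set
    ([staircase_translate]). Take scales [d n] decreasing as fast as [delta]
    demands, and let [F n] be the set of subset sums of [d 0, ..., d (n-1)].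
    The closure of the union of the [F n] is perfect, and it stays within
    [3 * d n] of the [2 ^ n] points of [F n]. Let [g] be the sum over [n] of
    [16 ^- n] times the sum over [F n] of ramps of slope [1 / (8 * d n)]. All
    terms are nondecreasing, so the [n]-th one alone shows that [g] gains at
    least [16 ^- n / 8] over a distance [d n] from a point of the Cantor set.
    This beats the oscillation of [f] up to distance [d (n - 1)], and the
    difference quotients of [f + g] tend to [+oo].

    For the complement, [g] oscillates at every point ([wave_translate]): it is
    the sum of [8 ^- n * wave (M n * x)] with frequencies [M n] growing as fast
    as [delta] demands. Every point has, within [2 / M n], a crest to its left
    and a trough to its right. From a point in the lower half of the [n]-th
    wave the crest is at least one amplitude higher, from a point in the upper
    half the trough is at least one amplitude lower; either way the difference
    quotient of [f + g] is nonpositive, since the earlier terms are nearly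
    constant at this scale and the later ones are too small to compensate. So
    [f + g] has derivative [+oo] nowhere. *)

Set Implicit Arguments.
Unset Strict Implicit.
Unset Printing Implicit Defensive.

Import Order.TTheory GRing.Theory Num.Theory.
Import numFieldNormedType.Exports.

Local Open Scope classical_set_scope.
Local Open Scope ring_scope.

(** * The interval [0,1] as a subtype *)

Lemma I01_itv (R : realType) (x : I01 R) : 0 <= val x <= 1.
Proof. by have /= := set_mem (valP x); rewrite in_itv. Qed.

Lemma nbhs_I01P (R : realType) (x : I01 R) (U : set (I01 R)) :
  nbhs x U <-> exists2 e : R, 0 < e & forall y, `|val x - val y| < e -> U y.
Proof.
split.
  move=> /nbhs_ballP[e e0 eU]; exists e => // y xy; exact: eU.
move=> [e e0 eU]; apply/nbhs_ballP; exists e => // y xy; exact: eU.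
Qed.

Lemma continuous_I01P (R : realType) (f : I01 R -> R) :
  continuous f <-> forall x e, 0 < e -> exists2 d : R, 0 < d &
    forall y : I01 R, `|val x - val y| < d -> `|f x - f y| < e.
Proof.
have FF x : Filter (nbhs (x : I01 R)) by exact: nbhs_filter.
split=> [cf x e e0|cf x].
  have /cvgrPdist_lt/(_ e e0)/nbhs_I01P[d d0 fd] := cf x.
  by exists d.
apply/cvgrPdist_lt => e e0; have [d d0 fd] := cf x e e0.
by apply/nbhs_I01P; exists d.
Qed.

Lemma closure_I01P (R : realType) (E : set (I01 R)) (x : I01 R) :
  closure E x <-> forall e, 0 < e -> exists2 y, E y & `|val x - val y| < e.
Proof.
split=> [Ex e e0|Ex U /nbhs_I01P[e e0 eU]].
  have /Ex[y [Ey xy]] : nbhs x [set y | `|val x - val y| < e].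
    by apply/nbhs_I01P; exists e.
  by exists y.
by have [y Ey xy] := Ex e e0; exists y; split => //; exact: eU.
Qed.

Lemma lipschitz_continuous_I01 (R : realType) (L : R) (f : I01 R -> R) :
  (forall x y, `|f x - f y| <= L * `|val x - val y|) -> continuous f.
Proof.
move=> fL; apply/continuous_I01P => x e e0.
have L1 : 0 < `|L| + 1 by rewrite ltr_pwDr.
exists (e / (`|L| + 1)) => [|y]; first by rewrite divr_gt0.
rewrite ltr_pdivlMr// mulrC; apply: le_lt_trans.
rewrite (le_trans (fL x y))// ler_wpM2r// (le_trans (ler_norm L))//.
by rewrite lerDl.
Qed.

(** Heine's theorem. Compactness is applied to the segment inside the reals,
    with the shrinking radius [d] as the parameter of the covering. *)
Lemma unif_continuous_I01 (R : realType) (f : C01 R) (e : R) : 0 < e ->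
  exists2 d : R, 0 < d &
    forall x y, `|val x - val y| <= d -> `|f x - f y| <= e.
Proof.
move=> e0; have e20 : 0 < e / 2 by rewrite divr_gt0.
pose P (d t : R) := forall x y : I01 R,
  val x = t -> `|t - val y| <= d -> `|f x - f y| <= e.
have cov : \forall d \near 0^'+, `[(0 : R), 1]%classic `<=` P d.
  apply: (proj1 (compact_near_coveringP _) (@segment_compact R 0 1)) => t t01.
  pose x0 : I01 R := SigSub (mem_set t01).
  have /continuous_I01P/(_ x0 _ e20)[d d0 fd] := @C01_fun_continuous _ f.
  have d20 : 0 < d / 2 by rewrite divr_gt0.
  near=> s h => x y /= xs.
  have ts : `|t - s| < d / 2 by near: s; apply/nbhs_ballP; exists (d / 2).
  have hd : h <= d / 2 by near: h; exact: nbhs_right_le.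
  move=> sy; have ty : `|t - val y| < d.
    rewrite (le_lt_trans (ler_distD s _ _))// [ltRHS]splitr ltr_leD//.
    exact: le_trans sy hd.
  rewrite (le_trans (ler_distD (f x0) _ _))// [leRHS]splitr lerD// ltW//.
    rewrite distrC fd//= xs (lt_le_trans ts)// ler_pdivrMr// ler_pMr//.
    by rewrite ler1n.
  exact: fd.
near (0 : R)^'+ => d.
exists d; first by near: d; exact: nbhs_right_gt.
have dP : `[(0 : R), 1]%classic `<=` P d by near: d.
by move=> x y; apply: dP => //; exact: set_mem (valP x).
Unshelve. all: end_near. Qed.

(** * A criterion for not being shy *)

(** When [eps] tends to 0, and up to a bound at one point, these are the
    compact sets of the Arzela-Ascoli theorem. *)
Definition modulus_set (R : realType) (delta eps : nat -> R) : set (C01 R) :=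
  [set f | forall n x y, `|val x - val y| <= delta n -> `|f x - f y| <= eps n].

(** The set is closed for uniform convergence: a strict excess of oscillation
    at one pair of points persists under small perturbations. *)
Lemma measurable_osc (R : realType) (d e : R) :
  measurable ([set f | forall x y, `|val x - val y| <= d -> `|f x - f y| <= e]
    : set (borel_C01 R)).
Proof.
rewrite -[X in measurable X]setCK; apply: measurableC.
apply: sub_sigma_algebra; apply/open_C01P => f /existsNP[x /existsNP[y]].
move=> /not_implyP[xy /negP]; rewrite -ltNge => fxy.
exists ((`|f x - f y| - e) / 2); first by rewrite divr_gt0// subr_gt0.
move=> g fg /(_ x y xy) gxy.
have := fg x; have := fg y; rewrite (distrC (f y)) => fgy fgx.
suff : `|f x - f y| <= `|f x - g x| + `|g x - g y| + `|g y - f y| by lra.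
rewrite (le_trans (ler_distD (g y) _ _))// lerD2r.
exact: ler_distD.
Qed.

Lemma measurable_translate (R : realType) (B : set (C01 R)) (g : C01 R) :
  measurable (B : set (borel_C01 R)) ->
  measurable ([set h + g | h in B] : set (borel_C01 R)).
Proof.
move=> mB.
have -> : [set h + g | h in B] = (fun h => h - g) @^-1` B.
  apply/seteqP; split=> [_ [h Bh <-]|h Bh] /=; first by rewrite addrK.
  by exists (h - g) => //; rewrite subrK.
have mtr : measurable_fun setT (fun h : borel_C01 R => h - g : borel_C01 R).
  apply: (@measurability _ _ (borel_C01 R) (borel_C01 R) _ _
    (@open (C01 R))) => // _ [U oU <-].
  apply: sub_sigma_algebra; rewrite setTI; apply/open_C01P => f /= Ufg.
  have /open_C01P/(_ _ Ufg)[e e0 eU] := oU.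
  exists e => // h fh; apply: eU => x; rewrite !C01_addE opprD addrACA.
  by rewrite subrr addr0.
by rewrite -[X in measurable X]setTI; exact: mtr.
Qed.

(** For fixed [n] the functions whose oscillation at scale [1 / m.+1] is at most
    [eps n] exhaust C[0,1] as [m] grows, so some [m] loses mass at most
    [2 ^- n.+2]; the total loss is then at most one half. *)
Lemma modulus_set_tight (R : realType) (mu : probability (borel_C01 R) R)
    (eps : nat -> R) : (forall n, 0 < eps n) ->
  exists2 delta : nat -> R, (forall n, 0 < delta n) &
    measurable (modulus_set delta eps : set (borel_C01 R)) /\
    mu (modulus_set delta eps) != 0%E.
Proof.
move=> eps0.
pose A n m : set (borel_C01 R) := [set f : C01 R | forall x y,
  `|val x - val y| <= m.+1%:R^-1 -> `|f x - f y| <= eps n].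
have mA n m : measurable (A n m) by exact: measurable_osc.
have AT n : \bigcup_m A n m = setT.
  apply/seteqP; split => // f _.
  have [d d0 fd] := unif_continuous_I01 f (eps0 n).
  have [m _ md] := near_infty_natSinv_lt (PosNum d0).
  exists m => // x y xy; apply: fd; apply: (le_trans xy); apply: ltW.
  exact: (md m (leqnn m)).
have Amu n : exists m, (mu (~` A n m) <= (2^-1 / (2 ^ n.+1)%:R)%:E)%E.
  have Ahomo : {homo A n : m m' / (m <= m')%N >-> (m <= m')%O}.
    move=> m m' mm'; apply/subsetPset => f Af x y xy; apply: Af.
    by rewrite (le_trans xy)// lef_pV2 ?posrE// ler_nat ltnS.
  have := nondecreasing_cvg_mu (mu := mu) (mA n) _ Ahomo.
  rewrite AT => /(_ measurableT) Acvg.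
  set c := 2^-1 / _; have c0 : 0 < c by rewrite divr_gt0// ltr0n expn_gt0.
  have : \forall m \near \oo, ((1 - c)%:E < mu (A n m))%E.
    apply: (Acvg (fun u => ((1 - c)%:E < u)%E)); apply: open_ereal_gt'.
    by rewrite [ltRHS](@probability_setT _ _ _ mu) lte_fin gtrBl.
  move=> [m _ /(_ m (leqnn m))/= cm]; exists m.
  rewrite probability_setC//; move: cm.
  rewrite -(fineK (fin_num_measure mu _ (mA n m))) -EFinB lee_fin lte_fin.
  by move=> ?; lra.
have [m mP] := choice Amu.
exists (fun n => (m n).+1%:R^-1) => [n|]; first by rewrite invr_gt0.
have KE : modulus_set (fun n => (m n).+1%:R^-1) eps = 
    ~` \bigcup_n ~` A n (m n).
  rewrite setC_bigcup; apply/seteqP; split=> [f Kf n _ Af|f Kf n x y xy].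
    by apply: Af => x y; exact: Kf.
  by have := Kf n I; rewrite setCK; exact.
have mU : measurable (\bigcup_n ~` A n (m n)).
  by apply: bigcupT_measurable => n; exact: measurableC.
rewrite KE; split; first exact: measurableC.
have : (mu (\bigcup_n ~` A n (m n)) <= (2^-1)%:E)%E.
  apply: le_trans (epsilon_trick0 xpredT _); last by rewrite invr_ge0.
  apply: le_trans (le_mu_bigcup _ _ mU) _ => [n|]; first exact: measurableC.
  by apply: lee_nneseries => [n _ _|n _]; [exact: measure_ge0|exact: mP].
rewrite probability_setC// -(fineK (fin_num_measure mu _ mU)) lee_fin => mU2.
by rewrite -EFinB eqe subr_eq0 gt_eqF// (le_lt_trans mU2)// invf_lt1 ?ltr1n.
Qed.

(** If [B] is a Borel set containing [A] all of whose translates are null, then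
    the translate [B - g] contains the whole modulus set, which has positive
    mass for a suitable [delta]. *)
Lemma not_shy_of_translates (R : realType) (eps : nat -> R) (A : set (C01 R)) :
  (forall n, 0 < eps n) ->
  (forall delta : nat -> R, (forall n, 0 < delta n) ->
    exists g : C01 R, forall f, modulus_set delta eps f -> A (f + g)) ->
  ~ shy A.
Proof.
move=> eps0 Ag [B [mu [mB AB Bmu]]].
have [delta delta0 [mK /negP]] := modulus_set_tight mu eps0; apply.
have [g KA] := Ag delta delta0.
rewrite -measure_le0 -(Bmu (- g)) le_measure ?inE//.
  exact: measurable_translate.
by move=> f Kf; exists (f + g); [exact/AB/KA|rewrite addrK].
Qed.

(** * Series of continuous functions with geometric bounds *)

Lemma expr8V_small (R : realType) (e : R) : 0 < e ->
  exists n, 8^-1 ^+ n < e.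
Proof.
move=> e0; have /cvgr_lt/(_ e e0)[n _ /(_ n (leqnn n))] :
  (GRing.exp (8^-1 : R) : R ^nat) @ \oo --> 0.
  by apply: cvg_expr; rewrite ger0_norm ?invf_lt1 ?invr_ge0 ?ltr1n.
by exists n.
Qed.

Lemma expr8V_gt0 (R : realType) n : 0 < (8^-1 : R) ^+ n.
Proof. by rewrite exprn_gt0// invr_gt0. Qed.

Lemma C01_sumE (R : realType) I (r : seq I) (u : I -> C01 R) x :
  (\sum_(i <- r) u i) x = \sum_(i <- r) u i x.
Proof. by elim/big_rec2: _ => // i y f _ <-. Qed.

Lemma geometric8_tail (R : realType) (v : nat -> R) n m :
  (forall k, `|v k| <= 8^-1 ^+ k) -> (n <= m)%N ->
  `|\sum_(0 <= k < m) v k - \sum_(0 <= k < n) v k| <= 2 * 8^-1 ^+ n.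
Proof.
move=> v8 nm.
(* The term [- 2 * 8^-1 ^+ m] is what makes the induction on [m] close. *)
suff : `|\sum_(0 <= k < m) v k - \sum_(0 <= k < n) v k| <=
    2 * 8^-1 ^+ n - 2 * 8^-1 ^+ m.
  have : 0 <= (8^-1 : R) ^+ m by rewrite exprn_ge0// invr_ge0.
  by move=> ? ?; lra.
rewrite -(subnKC nm); elim: (m - n)%N => [|j IHj].
  by rewrite addn0 !subrr normr0.
rewrite addnS big_nat_recr//= addrAC (le_trans (ler_normD _ _))//.
have : 0 <= (8^-1 : R) ^+ (n + j) by rewrite exprn_ge0// invr_ge0.
by have := v8 (n + j)%N; rewrite exprS; move: IHj => *; lra.
Qed.

Lemma geometric8_sum (R : realType) n : \sum_(0 <= k < n) 8^-1 ^+ k <= 2 :> R.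
Proof.
have := @geometric8_tail R (GRing.exp 8^-1) 0 n _ (leq0n n).
rewrite [X in _ - X]big_geq// subr0 expr0 mulr1 => h.
apply: le_trans (ler_norm _) (h _) => k.
by rewrite ger0_norm// ltW// expr8V_gt0.
Qed.

(** The Weierstrass test, with the tail bound that the constructions use to
    isolate one term. *)
Lemma uniform_series (R : realType) (u : nat -> C01 R) :
  (forall k x, `|u k x| <= 8^-1 ^+ k) ->
  exists g : C01 R, forall n x,
    `|g x - \sum_(0 <= k < n) u k x| <= 2 * 8^-1 ^+ n.
Proof.
move=> u8.
pose g x := limn (series (u ^~ x)).
have gE n x : `|g x - \sum_(0 <= k < n) u k x| <= 2 * 8^-1 ^+ n.
  have cv : cvgn (series (u ^~ x)).
    apply: normed_cvg.
    apply: (series_le_cvg (v_ := geometric 1 8^-1)) => [k|k|k|].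
    - exact: normr_ge0.
    - by rewrite /geometric/= mul1r exprn_ge0// invr_ge0.
    - by rewrite /geometric/= mul1r.
    - apply: is_cvg_geometric_series.
      by rewrite ger0_norm ?invf_lt1 ?invr_ge0 ?ltr1n.
  apply/ler_addgt0Pl => e e0.
  have gx : series (u ^~ x) @ \oo --> g x by exact: cv.
  move/cvgrPdist_le: gx => /(_ e e0)[N _ /(_ (maxn N n) (leq_maxl N n))/= gN].
  apply: (le_trans (ler_distD (series (u ^~ x) (maxn N n)) _ _)).
  rewrite lerD//; by apply: geometric8_tail; rewrite ?leq_maxr.
have gc : continuous g.
  apply/continuous_I01P => x e e0.
  have [|n ne] := @expr8V_small R (e / 8); first by rewrite divr_gt0.
  pose S : C01 R := \sum_(0 <= k < n) u k.
  have SE z : S z = \sum_(0 <= k < n) u k z by exact: C01_sumE.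
  have /continuous_I01P/(_ x (e / 3))[|d d0 ud] := @C01_fun_continuous _ S.
    by rewrite divr_gt0.
  exists d => // y /ud; rewrite !SE.
  have := gE n x; have := gE n y; rewrite !ler_norml ltr_norml.
  rewrite ltr_norml.
  by move=> /andP[? ?] /andP[? ?] /andP[? ?]; apply/andP; split; lra.
by exists (mkcts gc : continuousType _ _).
Qed.

(** When no term decreases from [x] to [z], each of them bounds the increment of
    the sum from below. *)
Lemma uniform_series_gain (R : realType) (u : nat -> C01 R) (g : C01 R) x z n :
  (forall n x, `|g x - \sum_(0 <= k < n) u k x| <= 2 * 8^-1 ^+ n) ->
  (forall k, u k x <= u k z) ->
  u n z - u n x <= g z - g x.
Proof.
move=> gu uxz; apply/ler_addgt0Pl => e e0.
have [|m me] := @expr8V_small R (e / 4); first by rewrite divr_gt0.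
pose N := maxn m n.+1.
have Nm : (8^-1 : R) ^+ N <= 8^-1 ^+ m.
  by rewrite ler_wiXn2l// ?leq_maxl// invf_le1// ler1n.
have gain : u n z - u n x <=
    \sum_(0 <= k < N) u k z - \sum_(0 <= k < N) u k x.
  rewrite -sumrB (big_cat_nat _ (n := n.+1)) ?leq_maxr//= big_nat_recr//=.
  by rewrite addrAC lerDr addr_ge0 ?sumr_ge0// => *; rewrite subr_ge0.
have := gu N x; have := gu N z; rewrite !ler_norml.
by move=> /andP[? ?] /andP[? ?]; lra.
Qed.

(** * Translates without any infinite derivative *)

(** The triangle wave of period 2 with crests 1 at even integers and troughs -1
    at odd ones: [2 * floor ((y + 1) / 2)] is the even integer nearest to
    [y]. *)
Definition wave (R : realType) (y : R) : R :=
  1 - 2 * `|y - 2 * (Num.floor ((y + 1) / 2))%:~R|.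

Lemma wave_nearest (R : realType) (y : R) (k : int) :
  `|y - 2 * (Num.floor ((y + 1) / 2))%:~R| <= `|y - 2 * k%:~R|.
Proof.
have := floor_itv ((y + 1) / 2); set j := Num.floor _.
rewrite intrD mulr1z => /andP[j1 j2].
have : `|y - 2 * j%:~R| <= 1 by rewrite ler_norml; apply/andP; split; lra.
have [->//|] := eqVneq k j.
rewrite neq_lt => /orP[|]; rewrite -lezD1 -(ler_int R) intrD mulr1z => jk j1'.
  by rewrite (le_trans j1')// (le_trans _ (ler_norm _))//; lra.
by rewrite (le_trans j1')// -normrN (le_trans _ (ler_norm _))//; lra.
Qed.

(** By [wave_nearest] the wave is an affine function of the distance to the set
    of even integers, and a distance function is 1-Lipschitz. *)
Lemma wave_lipschitz (R : realType) (x y : R) :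
  `|wave x - wave y| <= 2 * `|x - y|.
Proof.
have le a b : wave a - wave b <= 2 * `|a - b|.
  have := wave_nearest b (Num.floor ((a + 1) / 2)).
  have := ler_distD a b (2 * (Num.floor ((a + 1) / 2))%:~R).
  rewrite /wave (distrC b a); lra.
by rewrite ler_norml lerNl opprB le distrC le.
Qed.

Lemma wave_norm (R : realType) (y : R) : `|wave y| <= 1.
Proof.
have := floor_itv ((y + 1) / 2); rewrite intrD mulr1z /wave.
set j := (Num.floor _)%:~R => /andP[j1 j2].
have : `|y - 2 * j| <= 1 by rewrite ler_norml; apply/andP; split; lra.
have := normr_ge0 (y - 2 * j).
by move=> *; rewrite ler_norml; apply/andP; split; lra.
Qed.

Lemma wave_even (R : realType) (k : int) : wave (2 * k%:~R : R) = 1.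
Proof.
have := wave_nearest (2 * k%:~R : R) k.
rewrite subrr normr0 normr_le0 /wave => /eqP ->.
by rewrite normr0 mulr0 subr0.
Qed.

Lemma wave_odd (R : realType) (k : int) : wave (2 * k%:~R + 1 : R) = - 1.
Proof.
rewrite /wave (_ : (_ + 1 + 1) / 2 = (k + 1)%:~R :> R); last first.
  by rewrite intrD mulr1z; field.
rewrite intrKfloor intrD mulr1z.
rewrite (_ : 2 * _ + 1 - _ = - 1); last by ring.
by rewrite normrN normr1; ring.
Qed.

(** The odd frequency puts a crest at 0 and a trough at 1, so that the crest on
    the left and the trough on the right of [x] never leave [0,1]. If [w x] is
    nonpositive the crest is one unit higher, otherwise the trough is one unit
    lower. *)
Lemma wave_drop (R : realType) (N : nat) (x : I01 R) :
  let w (t : I01 R) := wave (N.*2.+1%:R * val t) in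
  exists z : I01 R, `|val x - val z| <= 2 / N.*2.+1%:R /\
    ((val z < val x /\ w x + 1 <= w z) \/ (val x < val z /\ w z + 1 <= w x)).
Proof.
move=> w; set M : R := N.*2.+1%:R.
have M0 : 0 < M by rewrite ltr0n.
have ME : M = 2 * N%:R + 1 by rewrite /M -addn1 natrD -mul2n natrM.
have /andP[x0 x1] := I01_itv x.
have xM : M * val x <= M by rewrite ler_piMr// ltW.
have xM0 : 0 <= M * val x by rewrite mulr_ge0// ltW.
have [wx0|wx0] := leP (w x) 0.
  set k := Num.floor (M * val x / 2).
  have := floor_itv (M * val x / 2); rewrite -/k intrD mulr1z => /andP[k1 k2].
  have k0 : 0 <= k%:~R :> R by rewrite ler0z floor_ge0 divr_ge0.
  pose t := 2 * k%:~R / M.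
  have Mt : M * t = 2 * k%:~R by rewrite /t mulrC divfK// gt_eqF.
  have tx : t <= val x by rewrite -(ler_pM2l M0) Mt; lra.
  have t01 : `[0, 1]%classic t.
    by rewrite /= in_itv/= (le_trans tx x1) divr_ge0// ?mulr_ge0// ltW.
  pose z : I01 R := SigSub (mem_set t01).
  have vz : val z = t by [].
  exists z; rewrite vz.
  have wt : w z = 1 by rewrite /w /= Mt wave_even.
  split.
    rewrite ger0_norm ?subr_ge0// ler_pdivlMr// mulrC mulrBr Mt.
    lra.
  left; rewrite wt; split; last lra.
  rewrite lt_neqAle tx andbT; apply: contraPneq wt => xt.
  by rewrite /w /= xt -/(w x); lra.
set k := Num.ceil ((M * val x - 1) / 2).
have := ceil_itv ((M * val x - 1) / 2); rewrite -/k intrB => /andP[k1 k2].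
pose t := (2 * k%:~R + 1) / M.
have Mt : M * t = 2 * k%:~R + 1 by rewrite /t mulrC divfK// gt_eqF.
have tx : val x <= t by rewrite -(ler_pM2l M0) Mt; lra.
have t01 : `[0, 1]%classic t.
  rewrite /= in_itv/= (le_trans x0 tx)/= ler_pdivrMr// mul1r ME lerD2r.
  rewrite ler_pM2l// -[N%:R]/(N%:Z%:~R) ler_int.
  rewrite -ltzD1 -(ltr_int R) intrD mulr1z.
  rewrite -[X in _ < X + _]/(N%:R : R); lra.
pose z : I01 R := SigSub (mem_set t01).
have vz : val z = t by [].
exists z; rewrite vz.
have wt : w z = - 1 by rewrite /w /= Mt wave_odd.
split.
  rewrite ler0_norm ?subr_le0// ler_pdivlMr// mulrC mulrN mulrBr Mt.
  lra.
right; rewrite wt; split; last lra.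
rewrite lt_neqAle tx andbT; apply: contraPneq wt => xt.
by rewrite /w /= -xt -/(w x); lra.
Qed.

(** The second condition makes the terms before the [n]-th one vary by at most
    [8 ^- n.+1] in total over a distance [2 / M n]. *)
Lemma wave_frequencies (R : realType) (delta : nat -> R) :
  (forall n, 0 < delta n) -> exists N : nat -> nat, forall n,
    2 / (N n).*2.+1%:R <= delta n /\
    forall k, (k < n)%N -> (64 * 8 ^ n * (N k).*2.+1 <= (N n).*2.+1)%N.
Proof.
move=> delta0.
pose b n := Num.bound (2 / delta n).
pose N := fix N n := if n is m.+1
  then (b n + 64 * 8 ^ n * (N m).*2.+1)%N else b n.
have bN n : (b n <= N n)%N by case: n => //= n; exact: leq_addr.
exists N => n; split.
  rewrite ler_pdivrMr ?ltr0n// -ler_pdivrMl// mulrC.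
  have /ltW := archi_boundP (ltW (divr_gt0 (ltr0n R 2) (delta0 n))).
  move=> /le_trans; apply; rewrite ler_nat -/(b n) (leq_trans (bN n))//.
  by rewrite -addnn leqW// leq_addr.
have Nmono : {homo N : m n / (m <= n)%N}.
  apply: homo_leq => [//|? ? ?|m]; first exact: leq_trans.
  rewrite /= (leq_trans _ (leq_addl _ _))// -addnn.
  rewrite (leq_trans _ (leq_pmull _ _)) ?muln_gt0 ?expn_gt0//.
  by rewrite leqW// leq_addr.
case: n => // n k; rewrite ltnS => /Nmono kn.
rewrite [N n.+1]/=; set C := (64 * _)%N.
have /(leq_mul (leqnn C))/leq_trans : ((N k).*2.+1 <= (N n).*2.+1)%N.
  by rewrite ltnS leq_double.
apply; rewrite leqW// -[(_ + _).*2]addnn -addnA (leq_trans _ (leq_addl _ _))//.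
exact: leq_addr.
Qed.

(** Arbitrarily close to [x] some difference quotient is nonpositive. *)
Lemma not_infinite_derivative (R : realType) (h : C01 R) (x : I01 R) :
  (forall e : R, 0 < e -> exists2 z : I01 R, `|val x - val z| < e &
    (val z < val x /\ h x <= h z) \/ (val x < val z /\ h z <= h x)) ->
  ~ infinite_derivative h x.
Proof.
move=> hx /cvgryPgt/(_ 0)/nbhs_I01P[e e0 he].
have [z xz [[zx hxz]|[xz' hzx]]] := hx e e0.
  have /he/(_ _) : `|val x - val z| < e by [].
  rewrite ltNge => /(_ _)/negP; apply.
    by apply: contraTneq zx => ->; rewrite ltxx.
  by rewrite mulr_ge0_le0 ?subr_ge0// invr_le0 subr_le0 ltW.
have /he/(_ _) : `|val x - val z| < e by [].
rewrite ltNge => /(_ _)/negP; apply.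
  by apply: contraTneq xz' => ->; rewrite ltxx.
by rewrite mulr_le0_ge0 ?subr_le0// invr_ge0 subr_ge0 ltW.
Qed.

(** At scale [2 / M n], in units of [8 ^- n], the [n]-th term moves by at least
    1 in the wrong direction, whereas [f] and the earlier terms move by at most
    1/8 each and the later terms by at most 1/2. *)
Lemma wave_translate (R : realType) (delta : nat -> R) :
  (forall n, 0 < delta n) ->
  exists g : C01 R, forall f, modulus_set delta (fun n => 8^-1 ^+ n.+1) f ->
    forall x, ~ infinite_derivative (f + g) x.
Proof.
move=> delta0.
(* The bound [8^-1 ^+ n] makes the crests and troughs converge to [x]. *)
pose delta' n := Num.min (delta n) (8^-1 ^+ n).
have [|N NP] := @wave_frequencies R delta'.
  by move=> n; rewrite lt_min delta0 expr8V_gt0.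
pose M n : R := (N n).*2.+1%:R.
have M0 n : 0 < M n by rewrite ltr0n.
pose w n (x : I01 R) := 8^-1 ^+ n * wave (M n * val x).
have wL n x y : `|w n x - w n y| <= 8^-1 ^+ n * (2 * M n) * `|val x - val y|.
  rewrite -mulrBr normrM (gtr0_norm (expr8V_gt0 _ _)) -!mulrA.
  rewrite ler_pM2l ?expr8V_gt0// (le_trans (wave_lipschitz _ _))//.
  by rewrite -mulrBr normrM gtr0_norm.
pose u n : C01 R :=
  mkcts (lipschitz_continuous_I01 (wL n)) : continuousType _ _.
have uE k t : u k t = 8^-1 ^+ k * wave (M k * val t) by [].
have [k x|g gP] := @uniform_series R u.
  by rewrite normrM (gtr0_norm (expr8V_gt0 _ _)) ler_piMr ?wave_norm.
exists g => f Kf x; apply: not_infinite_derivative => e e0.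
have [n ne] := expr8V_small e0; have n0 := expr8V_gt0 R n.
have [Mdelta Mfast] := NP n.
have [z []] := wave_drop (N n) x; rewrite -/(M n) => xz xzw.
have /andP[zdelta z8] : (`|val x - val z| <= delta n) &&
    (`|val x - val z| <= 8^-1 ^+ n).
  by rewrite -le_min (le_trans xz).
exists z; first exact: le_lt_trans ne.
have fxz := Kf n x z zdelta.
have low : `|\sum_(0 <= k < n) u k x - \sum_(0 <= k < n) u k z| <=
    8^-1 * 8^-1 ^+ n.
  have lowk k : (k < n)%N ->
      `|w k x - w k z| <= 8^-1 ^+ k * (16^-1 * 8^-1 ^+ n).
    move=> kn; rewrite (le_trans (wL k x z))// -mulrA ler_pM2l ?expr8V_gt0//.
    have Mk0 : 0 <= 2 * M k by rewrite mulr_ge0// ltW.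
    rewrite (le_trans (ler_wpM2l Mk0 xz))// mulrA ler_pdivrMr//.
    have := Mfast k kn; rewrite -(ler_nat R) !natrM natrX -/(M k) -/(M n).
    rewrite exprVn -ler_pdivlMl ?exprn_gt0// => ?; lra.
  rewrite -sumrB (le_trans (ler_norm_sum _ _ _))//.
  rewrite big_nat.
  rewrite (le_trans (ler_sum _ (fun k kn => lowk k (proj2 (andP kn)))))//.
  rewrite -big_nat -mulr_suml.
  have := ler_wpM2r (ltW n0) (geometric8_sum R n); lra.
have uS t : \sum_(0 <= k < n.+1) u k t = \sum_(0 <= k < n) u k t + u n t.
  by rewrite big_nat_recr.
have := gP n.+1 x; have := gP n.+1 z; rewrite !uS !uE exprS.
move: low fxz xzw; rewrite !C01_addE exprS.
set Sx := \sum_(0 <= k < n) _; set Sz := \sum_(0 <= k < n) _.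
rewrite !ler_norml.
move=> /andP[? ?] /andP[? ?] zw /andP[? ?] /andP[? ?].
case: zw => -[? ?]; [left|right]; split => //.
  have : 8^-1 ^+ n * (wave (M n * val x) + 1) <= 8^-1 ^+ n * wave (M n * val z).
    by rewrite ler_pM2l.
  move=> ?; lra.
have : 8^-1 ^+ n * (wave (M n * val z) + 1) <= 8^-1 ^+ n * wave (M n * val x).
  by rewrite ler_pM2l.
move=> ?; lra.
Qed.

(** * A thin perfect set of subset sums *)

Lemma fast_scales (R : realType) (delta : nat -> R) : (forall n, 0 < delta n) ->
  exists d : nat -> R,
    forall n, [/\ 0 < d n, d n <= delta n & 2 * d n.+1 <= d n].
Proof.
move=> delta0.
pose d := fix d n := if n is m.+1 then Num.min (delta n) (d m / 2) else delta 0.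
have d0 n : 0 < d n.
  by elim: n => [|n IHn]; rewrite /= ?lt_min delta0//= divr_gt0.
exists d => n; split => //; first by case: n => [|n]; rewrite /= ?ge_min lexx.
by rewrite mulrC -ler_pdivlMr//= ge_min lexx orbT.
Qed.

Section subset_sums.
Variables (R : realType) (d : nat -> R).
Hypothesis d_gt0 : forall n, 0 < d n.
Hypothesis d_half : forall n, 2 * d n.+1 <= d n.

Fixpoint subset_sums n : seq R :=
  if n is m.+1 then subset_sums m ++ [seq p + d m | p <- subset_sums m]
  else [:: 0].

Lemma size_subset_sums n : size (subset_sums n) = (2 ^ n)%N.
Proof.
by elim: n => //= n IHn; rewrite size_cat size_map IHn expnS mul2n addnn.
Qed.

Lemma subset_sums_mono m n : (m <= n)%N ->
  {subset subset_sums m <= subset_sums n}.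
Proof.
move=> /subnKC <-; elim: (n - m)%N => [|k IHk] p pm; first by rewrite addn0.
by rewrite addnS /= mem_cat IHk.
Qed.

(** Dropping the terms of index at least [m] from a subset sum loses at most
    [d m + ... + d n.-1], which is bounded by [2 * d m - 2 * d n] since the
    scales at least halve; the form with [- 2 * d n] is the one that survives
    induction on [n]. *)
Lemma subset_sums_prefix m n p : (m <= n)%N -> p \in subset_sums n ->
  exists2 q, q \in subset_sums m & q <= p <= q + 2 * d m - 2 * d n.
Proof.
move=> /subnKC <-; elim: (n - m)%N p => [|k IHk] p.
  by rewrite addn0 => pm; exists p => //; rewrite addrK lexx.
have := d_half (m + k); have := d_gt0 (m + k).
rewrite addnS /= mem_cat => dk0 dk /orP[pm|/mapP[p' p'm ->]].
  by have [q qm /andP[qp pq]] := IHk _ pm; exists q => //; rewrite qp/=; lra.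
have [q qm /andP[qp pq]] := IHk _ p'm; exists q => //.
by apply/andP; split; lra.
Qed.

Lemma scale_anti m n : (m <= n)%N -> d n <= d m.
Proof.
move=> /subnKC <-; elim: (n - m)%N => [|k IHk]; first by rewrite addn0.
rewrite addnS; have := d_half (m + k); have := d_gt0 (m + k).+1; lra.
Qed.

Lemma subset_sums_itv n p : p \in subset_sums n -> 0 <= p <= 2 * d 0%N.
Proof.
move=> /(subset_sums_prefix (leq0n n))[q]; rewrite inE => /eqP -> /andP[p0 pd].
by rewrite p0/=; have := d_gt0 n; lra.
Qed.

Definition all_subset_sums : set (I01 R) :=
  [set x | exists n, val x \in subset_sums n].

(** The covering property that makes the set thin: its closure is seen at scale
    [d n] from only [2 ^ n] points. *)
Lemma near_subset_sums n (x : I01 R) : closure all_subset_sums x ->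
  exists2 p, p \in subset_sums n & `|val x - p| <= 3 * d n.
Proof.
move=> /closure_I01P/(_ _ (d_gt0 n))[y [m ym]]; have dn := d_gt0 n.
rewrite ltr_norml => /andP[? ?].
have [mn|/ltnW nm] := leqP m n.
  exists (val y); first exact: subset_sums_mono ym.
  by rewrite ler_norml; apply/andP; split; lra.
have [p pn /andP[? ?]] := subset_sums_prefix nm ym; exists p => //.
by have := d_gt0 m; rewrite ler_norml => ?; apply/andP; split; lra.
Qed.

Hypothesis d_small : forall e : R, 0 < e -> exists n, d n < e.
Hypothesis d_le_half : d 0%N <= 2^-1.

Lemma subset_sums_I01 n p : p \in subset_sums n ->
  exists2 y : I01 R, val y = p & all_subset_sums y.
Proof.
move=> pn; have /andP[p0 p1] := subset_sums_itv pn.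
have p01 : `[0, 1]%classic p.
  rewrite /= in_itv/= p0/=; have := d_le_half; lra.
by exists (SigSub (mem_set p01)) => //; exists n.
Qed.

(** Next to a subset sum [y] there is, for every large [n], the other subset sum
    [y + d n]; at least one of the two differs from [x]. *)
Lemma perfect_closure_subset_sums : perfect_set (closure all_subset_sums).
Proof.
split; first exact: closed_closure.
apply/seteqP; split => x.
  move=> xP; have /closure_id -> := @closed_closure _ all_subset_sums.
  by move=> U /xP[y [_ Ey Uy]]; exists y.
move=> /closure_I01P Ex U /nbhs_I01P[e e0 eU].
have e20 : 0 < e / 2 by rewrite divr_gt0.
have [y [m ym] xy] := Ex _ e20; have [k ke] := d_small e20.
pose n := maxn m k.
have dn : d n < e / 2 by rewrite (le_lt_trans _ ke)// scale_anti// leq_maxr.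
have yn : val y + d n \in subset_sums n.+1.
  rewrite /= mem_cat; apply/orP; right; apply/mapP; exists (val y) => //.
  by apply: subset_sums_mono ym; exact: leq_maxl.
have [y' y'E Ey'] := subset_sums_I01 yn.
have Ey : all_subset_sums y by exists m.
have [yx|yx] := eqVneq y x; last first.
  exists y; split => //; first exact: subset_closure.
  by apply: eU; rewrite (lt_trans xy)// ltr_pdivrMr// ltr_pMr// ltr1n.
have y'x : val y' - val x = d n by rewrite y'E yx addrC addKr.
exists y'; split; last 2 first.
- exact: subset_closure.
- apply: eU; rewrite distrC y'x gtr0_norm ?d_gt0// (lt_trans dn)//.
  by rewrite ltr_pdivrMr// ltr_pMr// ltr1n.
apply: contraTneq (d_gt0 n) => y'xE.
by rewrite -y'x y'xE subrr ltxx.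
Qed.

End subset_sums.

(** * Translates with infinite derivative on a perfect set *)

Definition ramp (R : realType) (t : R) : R := Num.max (- 1) (Num.min 1 t).

Lemma ramp_id (R : realType) (t : R) : - 1 <= t <= 1 -> ramp t = t.
Proof. by move=> /andP[t1 t2]; rewrite /ramp (min_idPr t2) (max_idPr t1). Qed.

Lemma ramp_le (R : realType) (s t : R) : s <= t -> ramp s <= ramp t.
Proof.
move=> st; rewrite /ramp ge_max !le_max lexx/= orbC.
by rewrite (_ : Num.min 1 s <= Num.min 1 t)// le_min !ge_min lexx st orbT.
Qed.

Lemma ramp_norm (R : realType) (t : R) : `|ramp t| <= 1.
Proof.
by rewrite ler_norml /ramp le_max lexx/= ge_max ge_min lexx/= andbT; lra.
Qed.

Lemma ramp_lipschitz (R : realType) (s t : R) : `|ramp s - ramp t| <= `|s - t|.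
Proof.
wlog st : s t / t <= s.
  by move=> W; have [/W//|/ltW/W] := leP t s; rewrite distrC (distrC t).
rewrite !ger0_norm ?subr_ge0 ?ramp_le// /ramp !maxElt !minElt.
by case: (ltP 1 s) => ?; case: (ltP 1 t) => ?; do ?case: ltP => ?; lra.
Qed.

(** The [n]-th term has a ramp around each of the [2 ^ n] points of
    [subset_sums d n], with weight [16 ^- n] so that it is bounded by [8 ^- n].
    A point of the perfect set lies within [3 * d n] of the centre of one of
    these ramps, hence well inside its linear part, of half-width [8 * d n]. *)
Lemma staircase_series (R : realType) (d : nat -> R) :
  (forall n, 0 < d n) -> (forall n, 2 * d n.+1 <= d n) ->
  exists g : C01 R, forall n (x z : I01 R), val x < val z ->
    d n <= `|val x - val z| ->
    closure (all_subset_sums d) x \/ closure (all_subset_sums d) z ->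
    16^-1 ^+ n / 8 <= g z - g x.
Proof.
move=> d0 d2.
pose r n (p t : R) := ramp ((t - p) / (8 * d n)).
pose v n (x : I01 R) := 16^-1 ^+ n * \sum_(p <- subset_sums d n) r n p (val x).
have h16 n : 0 < (16^-1 : R) ^+ n by rewrite exprn_gt0// invr_gt0.
have vL n x y : `|v n x - v n y| <=
    16^-1 ^+ n * (\sum_(p <- subset_sums d n) (8 * d n)^-1) * `|val x - val y|.
  rewrite -mulrBr normrM gtr0_norm// -mulrA ler_pM2l// -sumrB mulr_suml.
  rewrite (le_trans (ler_norm_sum _ _ _))// ler_sum// => p _.
  rewrite (le_trans (ramp_lipschitz _ _))// -mulrBl opprB addrA subrK.
  by rewrite normrM [leRHS]mulrC (gtr0_norm (x := _^-1)) ?invr_gt0 ?mulr_gt0.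
have rle n p s t : s <= t -> r n p s <= r n p t.
  by move=> st; apply: ramp_le; rewrite ler_pM2r ?lerD2r// invr_gt0 mulr_gt0.
pose u n : C01 R :=
  mkcts (lipschitz_continuous_I01 (vL n)) : continuousType _ _.
have uE n t : u n t = v n t by [].
have [k x|g gP] := @uniform_series R u.
  rewrite uE normrM gtr0_norm//.
  have : `|\sum_(p <- subset_sums d k) r k p (val x)| <= 2 ^+ k.
    rewrite (le_trans (ler_norm_sum _ _ _))//.
    rewrite -natrX -(size_subset_sums d k) -sum1_size natr_sum ler_sum// => p _.
    exact: ramp_norm.
  move=> /(ler_wpM2l (ltW (h16 k)))/le_trans; apply.
  by rewrite -exprMn (_ : _ * _ = 8^-1)//; field.
have umono k (s t : I01 R) : val s <= val t -> u k s <= u k t.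
  by move=> st; rewrite !uE ler_pM2l// ler_sum// => p _; exact: rle.
exists g => n x z xz dxz xzP.
apply: le_trans (uniform_series_gain n gP _) => [|k].
  have dn := d0 n.
  have {}dxz : val x + d n <= val z.
    by move: dxz; rewrite distrC gtr0_norm ?subr_gt0// lerBrDl.
  have rD p t : - (4 * d n) <= t - p <= 4 * d n ->
      r n p (t + d n) - r n p t = 8^-1.
    move=> /andP[tp1 tp2]; have dn8 : 0 < 8 * d n by rewrite mulr_gt0.
    rewrite /r !ramp_id; first by field; rewrite gt_eqF.
      by rewrite ler_pdivlMr// ler_pdivrMr//; apply/andP; split; lra.
    by rewrite ler_pdivlMr// ler_pdivrMr//; apply/andP; split; lra.
  have [p pn rp] : exists2 p, p \in subset_sums d n &
      8^-1 <= r n p (val z) - r n p (val x).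
    case: xzP => /(near_subset_sums d0 d2 n)[p pn]; rewrite ler_norml;
      move=> /andP[tp1 tp2]; exists p => //.
      rewrite -(rD p (val x)); last by apply/andP; split; lra.
      by rewrite lerD2r rle.
    rewrite -(rD p (val z - d n)); last by apply/andP; split; lra.
    by rewrite subrK lerD2l lerN2 rle// lerBrDr.
  rewrite !uE /v -mulrBr ler_pM2l// -sumrB (big_rem p pn)/=.
  rewrite (le_trans rp)// lerDl sumr_ge0// => q _.
  by rewrite subr_ge0 rle// ltW.
exact/umono/ltW.
Qed.

(** Every [z] close to [x] has its distance to [x] between two consecutive
    scales, so a bound per scale controls all difference quotients. *)
Lemma infinite_derivative_scales (R : realType) (d : nat -> R) (h : C01 R)
    (x : I01 R) :
  (forall n, 0 < d n) -> (forall n, d n.+1 <= d n) ->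
  (forall n, d n <= 8^-1 ^+ n) ->
  (forall n z, d n.+1 <= `|val x - val z| <= d n -> z != x ->
     8 ^+ n <= (h z - h x) / (val z - val x)) ->
  infinite_derivative h x.
Proof.
move=> d0 dS d8 hd; apply/cvgryPgt => A; apply/nbhs_I01P.
have A1 : 0 < `|A| + 1 by rewrite ltr_pwDr.
have [|n0 n0A] := @expr8V_small R (`|A| + 1)^-1; first by rewrite invr_gt0.
exists (d n0) => // z xz /= zx.
have dist0 : 0 < `|val x - val z|.
  rewrite normr_gt0 subr_eq0; apply: contra_neq zx => /val_inj; exact: esym.
have exm : exists n, d n < `|val x - val z|.
  have [n ne] := expr8V_small dist0; exists n; exact: le_lt_trans ne.
case: (ex_minnP exm) => m dm mmin.
have danti i j : (i <= j)%N -> d j <= d i.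
  apply: (@homo_leq _ d (fun a b => b <= a)) => // ? ? ? /[swap].
  exact: le_trans.
have n0m : (n0 < m)%N.
  rewrite ltnNge; apply/negP => /danti mn0.
  by have := lt_trans (le_lt_trans mn0 dm) xz; rewrite ltxx.
case: m n0m => // m n0m in dm mmin *.
apply: lt_le_trans (hd m z _ zx); last first.
  by rewrite ltW//= leNgt; apply/negP => /mmin; rewrite ltnn.
apply: (le_lt_trans (ler_norm A)).
apply: (@lt_le_trans _ _ (8 ^+ n0)); last first.
  by rewrite ler_weXn2l// ler1n.
move: n0A; rewrite exprVn ltf_pV2 ?posrE ?exprn_gt0// => /(lt_trans _); apply.
by rewrite ltrDl.
Qed.

(** Between the scales [d n.+1] and [d n], [g] gains [2 * 16 ^- n.+2] and [f]
    loses at most half of it; the remaining [16 ^- n.+2] is at least [8 ^ n]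
    times the distance, by the choice of [delta']. *)
Lemma staircase_translate (R : realType) (delta : nat -> R) :
  (forall n, 0 < delta n) ->
  exists g : C01 R, forall f, modulus_set delta (fun n => 16^-1 ^+ n.+2) f ->
    infinite_derivative_on_perfect (f + g).
Proof.
move=> delta0.
have h16 n : 0 < (16^-1 : R) ^+ n by rewrite exprn_gt0// invr_gt0.
have h8 := expr8V_gt0 R.
pose delta' n := Num.min (delta n) (16^-1 ^+ n.+2 * 8^-1 ^+ n).
have [|d dP] := @fast_scales R delta'.
  by move=> n; rewrite lt_min delta0 mulr_gt0.
have d0 n : 0 < d n by have [] := dP n.
have d2 n : 2 * d n.+1 <= d n by have [] := dP n.
have ddelta n : d n <= delta n.
  by have [_ + _] := dP n; rewrite le_min => /andP[].
have d816 n : d n <= 16^-1 ^+ n.+2 * 8^-1 ^+ n.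
  by have [_ + _] := dP n; rewrite le_min => /andP[].
have d8 n : d n <= 8^-1 ^+ n.
  rewrite (le_trans (d816 n))// ler_piMl//.
  by rewrite exprn_ile1 ?invr_ge0// invf_le1 ?ler1n.
have dhalf : d 0%N <= 2^-1.
  have := d816 0%N; rewrite expr0 mulr1 expr2; lra.
have dsmall e : 0 < e -> exists n, d n < e.
  by move=> /expr8V_small[n ne]; exists n; exact: le_lt_trans ne.
have [g gP] := staircase_series d0 d2.
exists g => f Kf; exists (closure (all_subset_sums d)); split.
- have [|y _ yE] := @subset_sums_I01 R d d0 d2 dhalf 0%N 0.
    by rewrite inE.
  by exists y; exact: subset_closure.
- exact: perfect_closure_subset_sums.
move=> x xP; apply: (infinite_derivative_scales d0 _ d8) => [n|n z].
  by have := d0 n.+1; have := d2 n; lra.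
move=> /andP[nxz xzn] zx.
have fxz := Kf n x z (le_trans xzn (ddelta n)).
have q8 : 8 ^+ n * `|val z - val x| <= 16^-1 ^+ n.+2.
  rewrite distrC (le_trans (ler_wpM2l _ (le_trans xzn (d816 n))))//.
  by rewrite mulrCA -exprMn divff// expr1n mulr1.
have := h16 n.+2; have gain : 16^-1 ^+ n.+1 / 8 = 2 * 16^-1 ^+ n.+2 :> R.
  by rewrite [in RHS]exprS; field.
move: fxz; rewrite ler_norml => /andP[f1 f2] e0.
have [zltx|xltz|] := ltgtP (val z) (val x).
- have := gP n.+1 z x zltx; rewrite distrC gain => /(_ nxz (or_intror xP)) gzx.
  rewrite ler_ndivlMr ?subr_lt0//.
  move: q8; rewrite ltr0_norm ?subr_lt0// !C01_addE => q8; lra.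
- have := gP n.+1 x z xltz; rewrite gain => /(_ nxz (or_introl xP)) gzx.
  rewrite ler_pdivlMr ?subr_gt0//.
  move: q8; rewrite gtr0_norm ?subr_gt0// !C01_addE => q8; lra.
by move=> /val_inj zxE; rewrite zxE eqxx in zx.
Qed.

Theorem theorem6p1 (R : realType) :
  Haar_ambivalent (@infinite_derivative_on_perfect R).
Proof.
split.
  apply: (@not_shy_of_translates R (fun n => 16^-1 ^+ n.+2)) => [n|].
    by rewrite exprn_gt0// invr_gt0.
  exact: staircase_translate.
apply: (@not_shy_of_translates R (fun n => 8^-1 ^+ n.+1)) => [n|delta delta0].
  exact: expr8V_gt0.
have [g gP] := wave_translate delta0; exists g => f /gP fg [P [[x Px] _ PD]].
exact: fg (PD x Px).
Qed.
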